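(* Let $a,b$ be positive integers with $a\le b$. Every nonnegative integer can be written as $ax^2+by^2+4(z^2+zw+w^2)$ with $x,y,z,w\in\mathbb{Z}$ if and only if $a=1$ and $b=2$. *)

(* Defs.v *)
From Stdlib Require Import ZArith.
Open Scope Z_scope.

Definition form (a b x y z w : Z) : Z :=
  a * x ^ 2 + b * y ^ 2 + 4 * (z ^ 2 + z * w + w ^ 2).

Definition universal (a b : Z) : Prop :=
  forall n : Z, 0 <= n -> exists x y z w : Z, form a b x y z w = n.

(* Main.v *)
Require Import Defs.
From Stdlib Require Import ZArith Lia List Permutation Classical ClassicalEpsilon.
Open Scope Z_scope.

(** Since [4 (z^2 + zw + w^2) = (2z + w)^2 + 3 w^2], taking [w = 0] or [w = 1]
    reduces the universality of [x^2 + 2y^2 + 4(z^2 + zw + w^2)] to the claim that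
    every odd [m > 0] is of the form [x^2 + u^2 + 2y^2]. This is proved in the
    manner of Kronecker. Let [s m] be the number of such representations and [G m]
    the number of triples [a, r > 0] odd, [0 <= p < a] with [2p(a - p) + ra = m],
    which is positive because of [(1, 0, m)]. For odd [m],
    [sum_v s (m - 2v^2) = 4 sigma m] and [sum_v G (m - 2v^2) = sigma m], whence
    [s m = 4 G m] by induction.

    The first relation follows from Jacobi's two-square theorem by an argument of
    Dirichlet. The two-square theorem itself holds because both sides satisfy
    the recursion expressing [theta(q)^2 theta(-q) = theta(q) theta(-q^2)^2].
    The second relation is a class number relation; the substitution
    [v = p + k] makes the equation [2v^2 + 2p(a - p) + ra = m] linear in [p], and
    division with remainder then shows that all terms with [k <> 0] cancel. *)

Local Arguments Z.mul : simpl never.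
Local Arguments Z.add : simpl never.
Local Arguments Z.sub : simpl never.
Local Arguments Z.opp : simpl never.
Local Arguments Z.modulo : simpl never.
Local Arguments Z.div : simpl never.

(** * Sums over finite predicates *)

Definition enumerates {T : Type} (P : T -> Prop) (l : list T) : Prop :=
  NoDup l /\ forall x, In x l <-> P x.

Definition Fin {T : Type} (P : T -> Prop) : Prop := exists l, enumerates P l.

Definition lsum {T : Type} (F : T -> Z) (l : list T) : Z :=
  fold_right (fun x s => F x + s) 0 l.

(** Junk value [0] when [P] is infinite, so that reindexing needs no finiteness
    hypothesis. *)
Definition Sum {T : Type} (P : T -> Prop) (F : T -> Z) : Z :=
  match excluded_middle_informative (Fin P) with
  | left h => lsum F (proj1_sig (constructive_indefinite_description _ h))
  | right _ => 0
  end.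

Lemma lsum_perm {T} (F : T -> Z) l1 l2 :
  Permutation l1 l2 -> lsum F l1 = lsum F l2.
Proof. induction 1; simpl; lia. Qed.

Lemma lsum_app {T} (F : T -> Z) l1 l2 :
  lsum F (l1 ++ l2) = lsum F l1 + lsum F l2.
Proof. induction l1; simpl; lia. Qed.

Lemma lsum_ext {T} (F G : T -> Z) l :
  (forall x, In x l -> F x = G x) -> lsum F l = lsum G l.
Proof.
  induction l as [|x l IH]; simpl; intros H; [reflexivity|].
  rewrite H, IH; auto.
Qed.

Lemma lsum_map {T U} (f : T -> U) (F : U -> Z) l :
  lsum F (map f l) = lsum (fun x => F (f x)) l.
Proof. induction l; simpl; lia. Qed.

Lemma Sum_enum {T} (P : T -> Prop) F l : enumerates P l -> Sum P F = lsum F l.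
Proof.
  intros [nd el]. unfold Sum.
  destruct (excluded_middle_informative (Fin P)) as [h|h].
  - destruct (constructive_indefinite_description _ h) as [l' [nd' el']]; simpl.
    apply lsum_perm, NoDup_Permutation; auto.
    intros x; rewrite el, el'; tauto.
  - exfalso; apply h; exists l; split; assumption.
Qed.

Lemma Sum_infinite {T} (P : T -> Prop) F : ~ Fin P -> Sum P F = 0.
Proof.
  intros h; unfold Sum.
  destruct (excluded_middle_informative (Fin P)); [contradiction|reflexivity].
Qed.

Lemma NoDup_map_in {T U} (f : T -> U) l :
  (forall x y, In x l -> In y l -> f x = f y -> x = y) ->
  NoDup l -> NoDup (map f l).
Proof.
  intros inj nd; induction nd as [|x l nx nd IH]; simpl; constructor.
  - rewrite in_map_iff; intros (y & e & iy).
    apply nx. replace x with y; [assumption|]. apply inj; simpl; auto.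
  - apply IH; intros; apply inj; simpl; auto.
Qed.

Lemma enumerates_map {T U} (P : T -> Prop) (Q : U -> Prop) f g l :
  (forall x, P x -> Q (f x) /\ g (f x) = x) ->
  (forall y, Q y -> P (g y) /\ f (g y) = y) ->
  enumerates P l -> enumerates Q (map f l).
Proof.
  intros hf hg [nd el]; split.
  - apply NoDup_map_in; [|assumption].
    intros x y ix iy e. apply el in ix, iy.
    destruct (hf x ix) as [_ <-], (hf y iy) as [_ <-]. now rewrite e.
  - intros y; rewrite in_map_iff; split.
    + intros (x & <- & ix). apply el in ix. now apply hf.
    + intros qy. exists (g y). rewrite el. split; now apply hg.
Qed.

Lemma Sum_bij {T U} (f : T -> U) (g : U -> T) P Q F G :
  (forall x, P x -> Q (f x) /\ g (f x) = x /\ G (f x) = F x) ->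
  (forall y, Q y -> P (g y) /\ f (g y) = y) ->
  Sum P F = Sum Q G.
Proof.
  intros hf hg.
  assert (hf' : forall x, P x -> Q (f x) /\ g (f x) = x) by (intros x h; split; now apply hf).
  destruct (classic (Fin P)) as [[l hl]|nf].
  - rewrite (Sum_enum _ _ _ hl), (Sum_enum _ _ _ (enumerates_map _ _ f g l hf' hg hl)).
    rewrite lsum_map. apply lsum_ext; intros x ix. symmetry; apply hf, hl, ix.
  - rewrite (Sum_infinite P), (Sum_infinite Q); auto.
    intros [l hl]; apply nf; exists (map g l).
    now apply (enumerates_map Q P g f).
Qed.

Lemma Sum_ext {T} (P Q : T -> Prop) F G :
  (forall x, P x <-> Q x) -> (forall x, P x -> F x = G x) -> Sum P F = Sum Q G.
Proof.
  intros h e. apply (Sum_bij (fun x => x) (fun x => x)); intros x hx.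
  - rewrite <- h; repeat split; auto. symmetry; auto.
  - rewrite h; auto.
Qed.

Lemma Fin_sub {T} (P Q : T -> Prop) : Fin Q -> (forall x, P x -> Q x) -> Fin P.
Proof.
  intros [l [nd el]] h.
  exists (filter (fun x => if excluded_middle_informative (P x) then true else false) l).
  split; [now apply NoDup_filter|].
  intros x; rewrite filter_In, el.
  specialize (h x).
  destruct (excluded_middle_informative (P x)); split; intuition congruence.
Qed.

Lemma Fin_bij {T U} (f : T -> U) (g : U -> T) P Q :
  Fin P -> (forall x, P x -> Q (f x) /\ g (f x) = x) ->
  (forall y, Q y -> P (g y) /\ f (g y) = y) -> Fin Q.
Proof. intros [l hl] hf hg; exists (map f l); eauto using enumerates_map. Qed.

Lemma Sum_disj {T} (A B P : T -> Prop) F :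
  Fin P -> (forall x, P x <-> A x \/ B x) -> (forall x, A x -> B x -> False) ->
  Sum P F = Sum A F + Sum B F.
Proof.
  intros fP h d.
  destruct (Fin_sub A P fP) as [la ha]; [firstorder|].
  destruct (Fin_sub B P fP) as [lb hb]; [firstorder|].
  rewrite (Sum_enum _ _ _ ha), (Sum_enum _ _ _ hb), <- lsum_app.
  apply Sum_enum. destruct ha as [na ea], hb as [nb eb]; split.
  - apply NoDup_app; auto. intros x; rewrite ea, eb; eauto.
  - intros x; rewrite in_app_iff, ea, eb, h; tauto.
Qed.

Lemma lsum_scale {T} c (F : T -> Z) l :
  lsum (fun x => c * F x) l = c * lsum F l.
Proof. induction l; simpl; lia. Qed.

Lemma Sum_scale {T} c (P : T -> Prop) F :
  c * Sum P F = Sum P (fun x => c * F x).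
Proof.
  destruct (classic (Fin P)) as [[l hl]|nf].
  - now rewrite !(Sum_enum _ _ _ hl), lsum_scale.
  - rewrite !Sum_infinite; auto; lia.
Qed.

(** Reindexing along [f] turns the sum into its negative. At a fixed point of [f] the hypothesis
    forces [F] to vanish. *)
Lemma Sum_involution {T} (f : T -> T) P F :
  (forall x, P x -> P (f x) /\ f (f x) = x /\ F (f x) = - F x) -> Sum P F = 0.
Proof.
  intros h.
  assert (e : Sum P (fun x => -1 * F x) = Sum P F).
  { apply (Sum_bij f f); intros x px; destruct (h x px) as (? & ? & ?);
      repeat split; auto; lia. }
  rewrite <- Sum_scale in e; lia.
Qed.

Lemma Sum_empty {T} (P : T -> Prop) F : (forall x, ~ P x) -> Sum P F = 0.
Proof.
  intros h. rewrite (Sum_enum _ _ nil); [reflexivity|].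
  split; [constructor|]. intros x; specialize (h x); simpl; tauto.
Qed.

Lemma Sum_single {T} (a : T) (P : T -> Prop) F :
  (forall x, P x <-> x = a) -> Sum P F = F a.
Proof.
  intros h. rewrite (Sum_enum _ _ (a :: nil)); [simpl; lia|].
  split; [repeat constructor; simpl; tauto|].
  intros x; rewrite h; simpl; intuition.
Qed.

Lemma lsum_fibre {T U} (F : T -> U -> Z) (m : T -> list U) l :
  lsum (fun x => lsum (F x) (m x)) l =
  lsum (fun '(x, y) => F x y) (flat_map (fun x => map (pair x) (m x)) l).
Proof.
  induction l; simpl; [reflexivity|]. now rewrite lsum_app, lsum_map, IHl.
Qed.

Lemma Fin_list {T} (l : list T) : Fin (fun x => In x l).
Proof.
  exists (nodup (fun x y => excluded_middle_informative (x = y)) l).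
  split; [apply NoDup_nodup|]. intros x; apply nodup_In.
Qed.

Lemma Sum_fibre {T U} (P : T -> Prop) (Q : T -> U -> Prop) F :
  Fin P -> (forall x, P x -> Fin (Q x)) ->
  Sum P (fun x => Sum (Q x) (F x)) =
  Sum (fun '(x, y) => P x /\ Q x y) (fun '(x, y) => F x y).
Proof.
  intros [l [nd el]] fQ.
  (* The default [nil] arises only where [Q x] is infinite, hence never for [x] in [P]. *)
  pose (m x := match excluded_middle_informative (Fin (Q x)) with
               | left h => proj1_sig (constructive_indefinite_description _ h)
               | right _ => nil
               end).
  assert (hm : forall x, P x -> enumerates (Q x) (m x)).
  { intros x px. unfold m.
    destruct (excluded_middle_informative (Fin (Q x))) as [h|h];
      [now destruct (constructive_indefinite_description _ h)|].
    exfalso; auto. }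
  rewrite (Sum_enum _ _ l) by (split; assumption).
  rewrite (lsum_ext _ (fun x => lsum (F x) (m x)))
    by (intros x ix; now apply Sum_enum, hm, el).
  rewrite lsum_fibre. symmetry; apply Sum_enum; split.
  - assert (hl : forall x, In x l -> P x) by (intros; now apply el).
    clear el. induction nd as [|x l nx nd IH]; simpl; [constructor|].
    apply NoDup_app.
    + apply NoDup_map_in; [congruence|]. apply hm, hl; simpl; auto.
    + apply IH; intros; apply hl; simpl; auto.
    + intros [y z]; rewrite in_map_iff, in_flat_map.
      intros (z' & e & _) (y' & iy & iz). rewrite in_map_iff in iz.
      destruct iz as (z'' & e' & _). apply nx. congruence.
  - intros [x y]; rewrite in_flat_map; split.
    + intros (x' & ix & iy). rewrite in_map_iff in iy.
      destruct iy as (y' & e & iy). injection e as <- <-.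
      apply el in ix. split; [assumption|]. now apply hm.
    + intros [px qy]. exists x. rewrite el, in_map_iff; split; [assumption|].
      exists y; split; [reflexivity|]. now apply hm.
Qed.

Lemma Fin_prod {T U} (P : T -> Prop) (Q : U -> Prop) :
  Fin P -> Fin Q -> Fin (fun '(x, y) => P x /\ Q y).
Proof.
  intros [l [_ el]] [m [_ em]].
  apply Fin_sub with (1 := Fin_list (list_prod l m)).
  intros [x y]; now rewrite in_prod_iff, el, em.
Qed.

Lemma Fin_interval (N : Z) : Fin (fun x => - N <= x <= N).
Proof.
  apply Fin_sub with
    (1 := Fin_list (map (fun k => Z.of_nat k - N) (seq 0 (Z.to_nat (2 * N + 1))))).
  intros x h. apply in_map_iff. exists (Z.to_nat (x + N)).
  rewrite in_seq. lia.
Qed.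

Lemma Fin_box2 (N : Z) (P : Z * Z -> Prop) :
  (forall x y, P (x, y) -> - N <= x <= N /\ - N <= y <= N) -> Fin P.
Proof.
  intros h. eapply Fin_sub.
  - apply Fin_prod; apply (Fin_interval N).
  - intros [x y]; apply h.
Qed.

Lemma Fin_box3 (N : Z) (P : Z * Z * Z -> Prop) :
  (forall x y z, P (x, y, z) ->
     - N <= x <= N /\ - N <= y <= N /\ - N <= z <= N) -> Fin P.
Proof.
  intros h. eapply Fin_sub.
  - repeat apply Fin_prod; apply (Fin_interval N).
  - intros [[x y] z] p. apply h in p. tauto.
Qed.

Lemma Fin_box4 (N : Z) (P : Z * Z * Z * Z -> Prop) :
  (forall x y z t, P (x, y, z, t) ->
     - N <= x <= N /\ - N <= y <= N /\ - N <= z <= N /\ - N <= t <= N) -> Fin P.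
Proof.
  intros h. eapply Fin_sub.
  - repeat apply Fin_prod; apply (Fin_interval N).
  - intros [[[x y] z] t] p. apply h in p. tauto.
Qed.

Lemma Sum_prod {T U} (P : T -> Prop) (Q : U -> Prop) F G :
  Fin P -> Fin Q ->
  Sum P F * Sum Q G = Sum (fun '(x, y) => P x /\ Q y) (fun '(x, y) => F x * G y).
Proof.
  intros fP fQ.
  rewrite <- (Sum_fibre P (fun _ => Q) (fun x y => F x * G y)) by auto.
  rewrite Z.mul_comm, Sum_scale.
  apply Sum_ext; [tauto|]. intros x _. rewrite <- Sum_scale. lia.
Qed.

Lemma Sum_add {T} (P : T -> Prop) F G :
  Fin P -> Sum P F + Sum P G = Sum P (fun x => F x + G x).
Proof.
  intros [l hl]. rewrite !(Sum_enum _ _ _ hl). clear hl.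
  induction l; simpl; lia.
Qed.

(** * Sums of two squares *)

Ltac Zify.zify_post_hook ::= Z.to_euclidean_division_equations.

Ltac pair_lia :=
  repeat match goal with |- (_, _) = (_, _) => apply f_equal2 end; lia.

Definition odd (x : Z) : Prop := x mod 2 = 1.

Definition eps (i : Z) : Z := 1 - 2 * (i mod 2).

(** The nontrivial Dirichlet character mod 4, on odd arguments only. *)
Definition chi (a : Z) : Z := 2 - a mod 4.

Lemma eps_cases i : (i mod 2 = 0 /\ eps i = 1) \/ (i mod 2 = 1 /\ eps i = -1).
Proof. unfold eps; lia. Qed.

Lemma chi_shift a i : odd a -> chi (a + 2 * i) = chi a * eps i.
Proof.
  unfold odd, chi; intros.
  destruct (eps_cases i) as [[? ->]|[? ->]]; lia.
Qed.

Lemma chi_sqr a : odd a -> chi a * chi a = 1.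
Proof.
  unfold odd, chi; intros.
  assert (a mod 4 = 1 \/ a mod 4 = 3) as [->| ->] by lia; reflexivity.
Qed.

Lemma odd_mul a b : odd (a * b) <-> odd a /\ odd b.
Proof.
  unfold odd. rewrite Z.mul_mod by lia.
  assert (a mod 2 = 0 \/ a mod 2 = 1) as [->| ->] by lia;
  assert (b mod 2 = 0 \/ b mod 2 = 1) as [->| ->] by lia; simpl;
  unfold Z.modulo; simpl; lia.
Qed.

(** With [H(q)] the generating series of [h], this compares the coefficients of [q^n] in
    [theta(-q) H(q)] and [theta(q) H(-q^2)]; the sign is [eps i] because [i^2] and [i] have the same
    parity. *)
Definition theta_rec (h : Z -> Z) (n : Z) : Prop :=
  Sum (fun '(i, k) => 0 <= k /\ i * i + k = n) (fun '(i, k) => eps i * h k) =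
  Sum (fun '(i, k) => 0 <= k /\ i * i + 2 * k = n) (fun '(_, k) => eps k * h k).

Lemma Fin_theta n : Fin (fun '(i, k) => 0 <= k /\ i * i + k = n).
Proof. apply (Fin_box2 n). intros; nia. Qed.

Lemma Fin_theta2 n : Fin (fun '(i, k) => 0 <= k /\ i * i + 2 * k = n).
Proof. apply (Fin_box2 n). intros; nia. Qed.

(** On the left the term [i = 0] is [h n]. Every other term, on either side, involves [h] only below
    [n]: on the left because [i^2 > 0], on the right because [2k <= n] and [n > 0]. So the recursion
    determines [h] from [h 0]. *)
Lemma theta_rec_unique h1 h2 :
  h1 0 = h2 0 -> (forall n, 0 < n -> theta_rec h1 n /\ theta_rec h2 n) ->
  forall n, 0 <= n -> h1 n = h2 n.
Proof.
  intros h0 hrec.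
  enough (forall n, 0 <= n -> 0 <= n -> h1 n = h2 n) by auto.
  apply (Z_lt_induction (fun n => 0 <= n -> h1 n = h2 n)). intros n IH hn.
  destruct (Z.eq_dec n 0) as [->|n0]; [assumption|].
  destruct (hrec n ltac:(lia)) as [r1 r2]. unfold theta_rec in r1, r2.
  assert (step : forall h,
    Sum (fun '(i, k) => 0 <= k /\ i * i + k = n) (fun '(i, k) => eps i * h k) =
    h n + Sum (fun '(i, k) => 0 <= k /\ i * i + k = n /\ i <> 0)
              (fun '(i, k) => eps i * h k)).
  { intros h.
    rewrite (Sum_disj (fun p => p = (0, n))
              (fun '(i, k) => 0 <= k /\ i * i + k = n /\ i <> 0)).
    - rewrite (Sum_single (0, n)) by tauto. now rewrite Z.mul_1_l.
    - apply Fin_theta.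
    - intros [i k]; split.
      + intros [hk e]. destruct (Z.eq_dec i 0) as [->|]; [left|right; tauto].
        f_equal; lia.
      + intros [e|]; [injection e as -> ->; lia|tauto].
    - intros [i k] e; injection e as -> ->; lia. }
  rewrite step in r1, r2.
  assert (e1 : Sum (fun '(i, k) => 0 <= k /\ i * i + k = n /\ i <> 0)
                 (fun '(i, k) => eps i * h1 k) =
               Sum (fun '(i, k) => 0 <= k /\ i * i + k = n /\ i <> 0)
                 (fun '(i, k) => eps i * h2 k)).
  { apply Sum_ext; [tauto|]. intros [i k] (hk & e & i0). f_equal.
    apply IH; nia. }
  assert (e2 : Sum (fun '(i, k) => 0 <= k /\ i * i + 2 * k = n)
                 (fun '(_, k) => eps k * h1 k) =
               Sum (fun '(i, k) => 0 <= k /\ i * i + 2 * k = n)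
                 (fun '(_, k) => eps k * h2 k)).
  { apply Sum_ext; [tauto|]. intros [i k] (hk & e). f_equal.
    apply IH; nia. }
  lia.
Qed.

Definition rep2 (n : Z) : Z := Sum (fun '(x, y) => x * x + y * y = n) (fun _ => 1).

Lemma Fin_rep2 n : Fin (fun '(x, y) => x * x + y * y = n).
Proof. apply (Fin_box2 n). intros; nia. Qed.

Lemma rep2_0 : rep2 0 = 1.
Proof.
  unfold rep2. apply (Sum_single (0, 0)). intros [x y]; split.
  - intros; f_equal; nia.
  - intros e; injection e as -> ->; reflexivity.
Qed.

(** Coefficientwise [theta(q) theta(-q) = theta(-q^2)^2], multiplied by
    [theta(q)]. *)
Lemma theta_rec_rep2 n : theta_rec rep2 n.
Proof.
  unfold theta_rec, rep2.
  transitivity (Sum (fun '(i, x, y) => i * i + (x * x + y * y) = n)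
                  (fun '(i, x, y) => eps x)).
  { transitivity (Sum (fun p => let '(i, k) := p in 0 <= k /\ i * i + k = n)
      (fun p => Sum (fun '(x, y) => x * x + y * y = snd p) (fun _ => eps (fst p)))).
    { apply Sum_ext; [tauto|]. intros [i k] _. simpl. rewrite Sum_scale.
      apply Sum_ext; [tauto|]. intros; lia. }
    rewrite Sum_fibre by (try apply Fin_theta; intros; apply Fin_rep2).
    apply (Sum_bij (fun '((i, k), (x, y)) => (x, i, y))
                   (fun '(x, i, y) => ((i, x * x + y * y), (x, y)))).
    - intros [[i k] [x y]] [[hk e] e']; simpl in *; repeat split; try lia.
      repeat f_equal; lia.
    - intros [[x i] y] e; simpl; repeat split; nia. }
  rewrite (Sum_disj (fun '(i, x, y) => i * i + (x * x + y * y) = n /\ (x - y) mod 2 = 0)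
                    (fun '(i, x, y) => i * i + (x * x + y * y) = n /\ (x - y) mod 2 = 1)).
  2:{ apply (Fin_box3 n). intros; nia. }
  2:{ intros [[i x] y]. assert ((x - y) mod 2 = 0 \/ (x - y) mod 2 = 1) by lia. tauto. }
  2:{ intros [[i x] y]; lia. }
  (* When [x] and [y] have opposite parities, exchanging them reverses the sign [eps x]. *)
  rewrite (Sum_involution (fun '(i, x, y) => (i, y, x))
     (fun '(i, x, y) => i * i + (x * x + y * y) = n /\ (x - y) mod 2 = 1)).
  2:{ intros [[i x] y] [e p]; repeat split; try lia. unfold eps; lia. }
  symmetry. rewrite Z.add_0_r.
  transitivity (Sum (fun p => let '(i, k) := p in 0 <= k /\ i * i + 2 * k = n)
      (fun p => Sum (fun '(x, y) => x * x + y * y = snd p) (fun _ => eps (snd p)))).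
  { apply Sum_ext; [tauto|]. intros [i k] _. simpl. rewrite Sum_scale.
    apply Sum_ext; [tauto|]. intros; lia. }
  rewrite Sum_fibre by (try apply Fin_theta2; intros; apply Fin_rep2).
  (* A pair of equal parity is [(x + y, x - y)], with sum of squares [2 (x^2 + y^2) = 2k]; its sign
     [eps (x + y)] is [eps k], since squaring preserves parity. *)
  apply (Sum_bij (fun '((i, k), (x, y)) => (i, x + y, x - y))
           (fun '(i, x, y) => ((i, ((x + y) / 2) * ((x + y) / 2) + ((x - y) / 2) * ((x - y) / 2)),
                               ((x + y) / 2, (x - y) / 2)))).
  - intros [[i k] [x y]] [[hk e] e']; simpl in *.
    replace ((x + y + (x - y)) / 2) with x by lia.
    replace ((x + y - (x - y)) / 2) with y by lia.
    split; [split; [nia|lia]|split; [now rewrite e'|]].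
    subst k. unfold eps. do 2 f_equal.
    rewrite (Z.add_mod x), (Z.add_mod (x * x)), (Z.mul_mod x), (Z.mul_mod y) by lia.
    assert (x mod 2 = 0 \/ x mod 2 = 1) as [->| ->] by lia;
    assert (y mod 2 = 0 \/ y mod 2 = 1) as [->| ->] by lia; reflexivity.
  - intros [[i x] y] [e p]; simpl.
    assert (exists u v, x = u + v /\ y = u - v) as (u & v & -> & ->)
      by (exists ((x + y) / 2), ((x - y) / 2); lia).
    replace ((u + v + (u - v)) / 2) with u by lia.
    replace ((u + v - (u - v)) / 2) with v by lia.
    repeat split; nia.
Qed.

(** For [n > 0], the number of divisors congruent to 1 modulo 4 minus the number congruent to 3.
    Carrying the cofactor [d] along makes it available to substitutions. *)
Definition chi_div (n : Z) : Z :=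
  Sum (fun '(d, e) => 0 < d /\ 0 < e /\ odd e /\ d * e = n) (fun '(_, e) => chi e).

Lemma Fin_divs n : Fin (fun '(d, e) => 0 < d /\ 0 < e /\ odd e /\ d * e = n).
Proof. apply (Fin_box2 n). intros; nia. Qed.

(** The values of [chi] along 1, 3, 5, ... alternate between 1 and -1, and [b] of them are
    summed. *)
Lemma sum_chi_below b : 0 <= b ->
  Sum (fun a => 0 < a < 2 * b /\ odd a) chi = b mod 2.
Proof.
  intros hb. pattern b. apply natlike_ind; [| |assumption]; clear b hb.
  - apply Sum_empty. lia.
  - intros b hb IH.
    rewrite (Sum_disj (fun a => 0 < a < 2 * b /\ odd a) (fun a => a = 2 * b + 1)).
    + rewrite IH, (Sum_single (2 * b + 1)) by tauto. unfold chi; lia.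
    + apply Fin_sub with (1 := Fin_interval (2 * b + 2)). lia.
    + unfold odd; lia.
    + lia.
Qed.

(** Liouville's substitution: [n = i^2 + d e] becomes [4n = 4b^2 + a^2 - c^2]
    with [(a, b, c) = (e - 2i, d + i, 2d + 2i - e)]; the terms with [|a| < c]
    cancel under [a -> -a], those with [a > |c|] are paired by
    [(b, c) -> (-b, -c)], and [a = c] only occurs when [n] is a square. *)
Lemma liouville_chi n : 0 < n ->
  Sum (fun '(i, d, e) => 0 < d /\ 0 < e /\ odd e /\ i * i + d * e = n)
      (fun '(i, _, e) => eps i * chi e) =
  Sum (fun '(i, d, e) => 0 < d /\ 0 < e /\ odd e /\ i * i + 2 * (d * e) = n)
      (fun '(_, d, e) => eps d * chi e) +
  Sum (fun '(b, a) => (0 < b /\ b * b = n) /\ (0 < a < 2 * b /\ odd a))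
      (fun '(_, a) => chi a).
Proof.
  intros hn.
  (* In these coordinates [a + c = 2d] and [2b - c = e], so the two inequalities express [d > 0] and
     [e > 0]. *)
  pose (X := fun '(a, b, c) =>
    odd a /\ odd c /\ 4 * (b * b) + a * a - c * c = 4 * n /\ 0 < a + c /\ c < 2 * b).
  pose (P := fun '(i, d, e) => 0 < d /\ 0 < e /\ odd e /\ i * i + d * e = n).
  pose (f := fun '(i, d, e) => (e - 2 * i, d + i, 2 * d + 2 * i - e)).
  pose (g := fun '(a, b, c) => (b - (a + c) / 2, (a + c) / 2, 2 * b - c)).
  assert (hf : forall x, P x -> X (f x) /\ g (f x) = x).
  { unfold P, X, f, g, odd. intros [[i d] e] (hd & he & oe & eq). split; [|pair_lia].
    repeat split; pair_lia. }
  assert (hg : forall y, X y -> P (g y) /\ f (g y) = y).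
  { unfold P, X, f, g, odd. intros [[a b] c] (oa & oc & eq & hac & hcb).
    split; [|pair_lia].
    assert (exists d, a = 2 * d - c) as [d ->] by (exists ((a + c) / 2); lia).
    replace ((2 * d - c + c) / 2) with d by lia.
    repeat split; pair_lia. }
  assert (fX : Fin X).
  { apply (Fin_bij f g P); auto. apply (Fin_box3 n). unfold P; intros; nia. }
  transitivity (Sum X (fun '(a, _, _) => chi a)).
  { apply (Sum_bij f g); [|exact hg].
    intros x px. destruct (hf x px) as [? ?]. repeat split; auto.
    destruct x as [[i d] e]. destruct px as (? & ? & ? & ?).
    unfold f. replace (e - 2 * i) with (e + 2 * - i) by lia.
    rewrite chi_shift, Z.mul_comm by assumption. f_equal. unfold eps; lia. }
  rewrite (Sum_disj (fun '(a, b, c) => X (a, b, c) /\ a < c)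
                    (fun '(a, b, c) => X (a, b, c) /\ c <= a));
    [|exact fX
     |intros [[a b] c]; assert (a < c \/ c <= a) by lia; tauto
     |intros [[a b] c] [_ ?] [_ ?]; lia].
  rewrite (Sum_involution (fun '(a, b, c) => (- a, b, c))
             (fun '(a, b, c) => X (a, b, c) /\ a < c)).
  2:{ intros [[a b] c] [(oa & oc & eq & hac & hcb) hlt]. unfold X, odd, chi in *.
      repeat split; pair_lia. }
  rewrite Z.add_0_l.
  rewrite (Sum_disj (fun '(a, b, c) => X (a, b, c) /\ c < a)
                    (fun '(a, b, c) => X (a, b, c) /\ c = a)).
  2:{ apply (Fin_sub _ X fX). intros [[a b] c]; tauto. }
  2:{ intros [[a b] c]. assert (c <= a <-> c < a \/ c = a) by lia. tauto. }
  2:{ intros [[a b] c] [_ ?] [_ ?]; lia. }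
  f_equal.
  (* The halves of [a + c] and [a - c] add up to the odd number [a]; the even half is [2d] and the
     odd one is [e], so that [a^2 - c^2 = 8de]. Conversely [(b, c)] is [(j, 2d - e)] or its
     negative, and since [c] is odd exactly one of the two satisfies [c < 2b]. *)
  - apply (Sum_bij
      (fun '(a, b, c) => if Z.eq_dec (((a + c) / 2) mod 2) 0
                         then (b, (a + c) / 4, (a - c) / 2)
                         else (- b, (a - c) / 4, (a + c) / 2))
      (fun '(j, d, e) => if Z_lt_dec (2 * d - e) (2 * j)
                         then (2 * d + e, j, 2 * d - e)
                         else (2 * d + e, - j, e - 2 * d))).
    + intros [[a b] c] [(oa & oc & eq & hac & hcb) hlt]. unfold odd in *.
      destruct (Z.eq_dec (((a + c) / 2) mod 2) 0) as [ev|od].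
      * assert (exists d e, a = 2 * d + e /\ c = 2 * d - e) as (d & e & -> & ->)
          by (exists ((a + c) / 4), ((a - c) / 2); lia).
        replace ((2 * d + e + (2 * d - e)) / 4) with d by lia.
        replace ((2 * d + e - (2 * d - e)) / 2) with e by lia.
        destruct (Z_lt_dec (2 * d - e) (2 * b)); [|lia].
        repeat split; try pair_lia.
        rewrite Z.mul_comm, <- chi_shift by (unfold odd; lia). f_equal; lia.
      * assert (exists d e, a = 2 * d + e /\ c = e - 2 * d) as (d & e & -> & ->).
        { exists ((a - c) / 4), ((a + c) / 2).
          assert ((a - c) mod 4 = 0).
          { assert ((4 * (b * b) + a * a - c * c) mod 4 = 0) by lia. lia. }
          lia. }
        replace ((2 * d + e - (e - 2 * d)) / 4) with d by lia.
        replace ((2 * d + e + (e - 2 * d)) / 2) with e by lia.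
        destruct (Z_lt_dec (2 * d - e) (2 * - b)); [lia|].
        rewrite Z.opp_involutive.
        repeat split; try pair_lia.
        rewrite Z.mul_comm, <- chi_shift by (unfold odd; lia). f_equal; lia.
    + intros [[j d] e] (hd & he & oe & eq). unfold X, odd in *.
      destruct (Z_lt_dec (2 * d - e) (2 * j)).
      * replace ((2 * d + e + (2 * d - e)) / 4) with d by lia.
        replace ((2 * d + e - (2 * d - e)) / 2) with e by lia.
        destruct (Z.eq_dec (((2 * d + e + (2 * d - e)) / 2) mod 2) 0); [|lia].
        repeat split; pair_lia.
      * replace ((2 * d + e - (e - 2 * d)) / 4) with d by lia.
        replace ((2 * d + e + (e - 2 * d)) / 2) with e by lia.
        destruct (Z.eq_dec (e mod 2) 0); [lia|].
        rewrite Z.opp_involutive. repeat split; pair_lia.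
  - apply (Sum_bij (fun '(a, b, c) => (b, a)) (fun '(b, a) => (a, b, a))).
    + intros [[a b] c] [(oa & oc & eq & hac & hcb) <-]. repeat split; auto; pair_lia.
    + intros [b a] ((hb & e) & ha & oa). unfold X. repeat split; auto; pair_lia.
Qed.

Lemma eps_mul_odd d e : odd e -> eps (d * e) = eps d.
Proof.
  intros oe. unfold eps. do 2 f_equal.
  rewrite Z.mul_mod, oe by lia. lia.
Qed.

(** This balances the terms [k = 0] of the theta recursion against the correction in
    [liouville_chi]. For [n = b^2] with [b > 0] it reads [4 (b mod 2) + 2 eps b = 2], by
    [sum_chi_below]; otherwise all sums are empty. *)
Lemma square_terms n : 0 < n ->
  4 * Sum (fun '(b, a) => (0 < b /\ b * b = n) /\ (0 < a < 2 * b /\ odd a))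
          (fun '(_, a) => chi a) +
  Sum (fun i => i * i = n) eps = Sum (fun i => i * i = n) (fun _ => 1).
Proof.
  intros hn.
  assert (fin : Fin (fun i => i * i = n)).
  { apply Fin_sub with (1 := Fin_interval n). intros; nia. }
  rewrite <- (Sum_fibre (fun b => 0 < b /\ b * b = n) (fun b a => 0 < a < 2 * b /\ odd a)
                (fun _ a => chi a)).
  2:{ apply Fin_sub with (1 := fin); tauto. }
  2:{ intros b _. apply Fin_sub with (1 := Fin_interval (2 * b)). lia. }
  assert (split2 : forall F, (forall i, F (- i) = F i) ->
    Sum (fun i => i * i = n) F = 2 * Sum (fun b => 0 < b /\ b * b = n) F).
  { intros F hF.
    rewrite (Sum_disj (fun i => 0 < i /\ i * i = n) (fun i => i < 0 /\ i * i = n));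
      [|exact fin|intros; nia|lia].
    rewrite (Sum_bij Z.opp Z.opp (fun i => i < 0 /\ i * i = n)
                     (fun i => 0 < i /\ i * i = n) F F); [lia| |].
    - intros x ?; rewrite hF; repeat split; lia.
    - intros y ?; repeat split; lia. }
  rewrite !split2 by (intros; unfold eps; lia).
  assert (fin' : Fin (fun b => 0 < b /\ b * b = n))
    by (apply Fin_sub with (1 := fin); tauto).
  rewrite !Sum_scale, Sum_add by assumption.
  apply Sum_ext; [tauto|]. intros b [hb _].
  rewrite sum_chi_below by lia. unfold eps; lia.
Qed.

Lemma Sum_divs_fibre (P : Z * Z -> Prop) (u : Z * Z -> Z) :
  Fin P ->
  Sum P (fun '(i, k) => u (i, k) * chi_div k) =
  Sum (fun '(p, (d, e)) => P p /\ (0 < d /\ 0 < e /\ odd e /\ d * e = snd p))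
      (fun '(p, (_, e)) => u p * chi e).
Proof.
  intros fP.
  transitivity (Sum P (fun p =>
    Sum (fun '(d, e) => 0 < d /\ 0 < e /\ odd e /\ d * e = snd p)
        (fun '(_, e) => u p * chi e))).
  { apply Sum_ext; [tauto|]. intros [i k] _. unfold chi_div. rewrite Sum_scale.
    apply Sum_ext; [tauto|]. now intros [d e] _. }
  rewrite Sum_fibre by (auto using Fin_divs).
  apply Sum_ext; intros [p [d e]]; tauto.
Qed.

(** The value 1 at [k = 0] is [rep2 0]. The terms with [k > 0] give four times the two divisor sums
    of [liouville_chi], and [square_terms] accounts for the rest. *)
Lemma theta_rec_chi_div n : 0 < n ->
  theta_rec (fun k => if Z.eq_dec k 0 then 1 else 4 * chi_div k) n.
Proof.
  intros hn. unfold theta_rec.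
  rewrite (Sum_disj (fun '(i, k) => k = 0 /\ i * i = n)
                    (fun '(i, k) => 0 < k /\ i * i + k = n));
    [|apply Fin_theta|intros [i k]; lia|intros [i k]; lia].
  rewrite (Sum_disj (fun '(i, k) => k = 0 /\ i * i = n)
                    (fun '(i, k) => 0 < k /\ i * i + 2 * k = n)
                    (fun '(i, k) => 0 <= k /\ i * i + 2 * k = n));
    [|apply Fin_theta2|intros [i k]; lia|intros [i k]; lia].
  rewrite (Sum_bij fst (fun i => (i, 0)) (fun '(i, k) => k = 0 /\ i * i = n)
             (fun i => i * i = n) _ eps).
  2:{ intros [i k] [-> e]; cbn [fst]; destruct (Z.eq_dec 0 0); [|lia]; repeat split; unfold eps; lia. }
  2:{ intros i e; repeat split; lia. }
  rewrite (Sum_bij fst (fun i => (i, 0)) (fun '(i, k) => k = 0 /\ i * i = n)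
             (fun i => i * i = n) (fun '(_, k) => eps k * _) (fun _ => 1)).
  2:{ intros [i k] [-> e]; cbn [fst]; destruct (Z.eq_dec 0 0); [|lia]; repeat split; unfold eps; lia. }
  2:{ intros i e; repeat split; lia. }
  assert (e1 : Sum (fun '(i, k) => 0 < k /\ i * i + k = n)
      (fun '(i, k) => eps i * (if Z.eq_dec k 0 then 1 else 4 * chi_div k)) =
    4 * Sum (fun '(i, d, e) => 0 < d /\ 0 < e /\ odd e /\ i * i + d * e = n)
      (fun '(i, _, e) => eps i * chi e)).
  { transitivity (4 * Sum (fun '(i, k) => 0 < k /\ i * i + k = n)
                          (fun '(i, k) => eps i * chi_div k)).
    { rewrite Sum_scale. apply Sum_ext; [tauto|]. intros [i k] [hk _].
      destruct (Z.eq_dec k 0); lia. }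
    rewrite (Sum_divs_fibre _ (fun '(i, _) => eps i)).
    2:{ apply Fin_sub with (1 := Fin_theta n). intros [i k]; lia. }
    f_equal. apply (Sum_bij (fun '((i, k), (d, e)) => (i, d, e))
                            (fun '(i, d, e) => ((i, d * e), (d, e)))).
    - intros [[i k] [d e]] [[hk eq] (hd & he & oe & eq')]; simpl in *.
      repeat split; auto; pair_lia.
    - intros [[i d] e] (hd & he & oe & eq); simpl. repeat split; auto; nia. }
  assert (e2 : Sum (fun '(i, k) => 0 < k /\ i * i + 2 * k = n)
      (fun '(_, k) => eps k * (if Z.eq_dec k 0 then 1 else 4 * chi_div k)) =
    4 * Sum (fun '(i, d, e) => 0 < d /\ 0 < e /\ odd e /\ i * i + 2 * (d * e) = n)
      (fun '(_, d, e) => eps d * chi e)).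
  { transitivity (4 * Sum (fun '(i, k) => 0 < k /\ i * i + 2 * k = n)
                          (fun '(i, k) => eps k * chi_div k)).
    { rewrite Sum_scale. apply Sum_ext; [tauto|]. intros [i k] [hk _].
      destruct (Z.eq_dec k 0); lia. }
    rewrite (Sum_divs_fibre _ (fun '(_, k) => eps k)).
    2:{ apply Fin_sub with (1 := Fin_theta2 n). intros [i k]; lia. }
    f_equal. apply (Sum_bij (fun '((i, k), (d, e)) => (i, d, e))
                            (fun '(i, d, e) => ((i, d * e), (d, e)))).
    - intros [[i k] [d e]] [[hk eq] (hd & he & oe & eq')]; simpl in *. subst k.
      repeat split; auto; try lia. now rewrite eps_mul_odd.
    - intros [[i d] e] (hd & he & oe & eq); simpl. repeat split; auto; nia. }
  rewrite e1, e2, liouville_chi by assumption.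
  pose proof (square_terms n hn). lia.
Qed.

Lemma rep2_chi_div n : 0 < n -> rep2 n = 4 * chi_div n.
Proof.
  intros hn.
  rewrite (theta_rec_unique rep2 (fun k => if Z.eq_dec k 0 then 1 else 4 * chi_div k)).
  - destruct (Z.eq_dec n 0); lia.
  - apply rep2_0.
  - intros k hk; split; [apply theta_rec_rep2|now apply theta_rec_chi_div].
  - lia.
Qed.

(** For odd [n] exactly one of [x] and [y] is odd, so exchanging them shows that half of the
    [4 chi_div n] representations have [x] odd. *)
Lemma odd_even_squares n : 0 < n -> odd n ->
  Sum (fun '(x, y) => odd x /\ x * x + y * y = n) (fun _ => 1) = 2 * chi_div n.
Proof.
  intros hn on.
  pose proof (rep2_chi_div n hn) as h. unfold rep2 in h.
  rewrite (Sum_disj (fun '(x, y) => odd x /\ x * x + y * y = n)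
                    (fun '(x, y) => odd y /\ x * x + y * y = n)) in h.
  - rewrite (Sum_bij (fun '(x, y) => (y, x)) (fun '(x, y) => (y, x))
               (fun '(x, y) => odd y /\ x * x + y * y = n)
               (fun '(x, y) => odd x /\ x * x + y * y = n) _ (fun _ => 1)) in h; [lia| |].
    + intros [x y] [? ?]; repeat split; auto; lia.
    + intros [x y] [? ?]; repeat split; auto; lia.
  - apply Fin_rep2.
  - intros [x y]. pose proof (odd_mul x x). pose proof (odd_mul y y).
    unfold odd in *; lia.
  - intros [x y] [? e] [? _]. pose proof (odd_mul x x). pose proof (odd_mul y y).
    unfold odd in *; lia.
Qed.

(** * Four squares *)

(** Since [m/a] is odd there are [m/a] pairs [(r, p)] for each divisor [a]: this
    is [sigma m] for odd [m]. *)
Definition Dcount (m : Z) : Z :=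
  Sum (fun '(a, r, p) => 0 < a /\ odd a /\ 0 < r /\ odd r /\ a * (r + 2 * Z.abs p) = m)
      (fun _ => 1).

Lemma divmod_unique a b q r : 0 <= r < b -> a = b * q + r -> a / b = q /\ a mod b = r.
Proof.
  intros h e. split.
  - symmetry. now apply (Z.div_unique_pos a b q r).
  - symmetry. now apply (Z.mod_unique_pos a b q r).
Qed.

(** Swapping [e] and [f], which have opposite parities, while reducing [c]
    modulo [2e]. *)
Lemma dirichlet_cancel m : odd m ->
  Sum (fun '(e, f, b, c) => 0 < e /\ 0 < f /\ 0 < b < 2 * f /\ odd b /\ 0 < c /\ odd c /\
                            e * b + f * c = m)
      (fun '(e, _, _, _) => eps e) = 0.
Proof.
  intros om.
  apply (Sum_involution
    (fun '(e, f, b, c) => (f, e, c mod (2 * e), b + 2 * f * (c / (2 * e))))).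
  intros [[[e f] b] c] (he & hf & hb & ob & hc & oc & eq).
  pose proof (Z.div_mod c (2 * e) ltac:(lia)) as dm.
  pose proof (Z.mod_pos_bound c (2 * e) ltac:(lia)) as mb.
  pose proof (Z.div_pos c (2 * e) ltac:(lia) ltac:(lia)) as kp.
  revert dm mb kp. generalize (c / (2 * e)) (c mod (2 * e)). intros k b' -> mb kp.
  assert (ob' : odd b') by (unfold odd in *; lia).
  assert (0 < b') by (unfold odd in *; lia).
  (* The new last coordinate has quotient [k] and remainder [b] modulo [2f], so a second application
     restores the tuple. *)
  destruct (divmod_unique (b + 2 * f * k) (2 * f) k b ltac:(lia) ltac:(lia)) as [-> ->].
  repeat split; try assumption; try pair_lia.
  - unfold odd in *; lia.
  - assert (ef : (e + f) mod 2 = 1).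
    { rewrite <- om, <- eq. unfold odd in *.
      rewrite (Z.add_mod (e * b)), (Z.mul_mod e b), (Z.mul_mod f) by lia.
      rewrite ob, oc. lia. }
    unfold eps; lia.
Qed.

(** The left side is the sum of [chi_div i * chi_div j] over odd positive [i + j = 2m]. Its terms
    with [a <> c] cancel; those with [a = c] have weight 1 and are counted by [Dcount]. *)
Lemma dirichlet m : 0 < m -> odd m ->
  Sum (fun '(a, b, c, d) => (0 < a /\ odd a /\ 0 < b /\ odd b) /\
                            (0 < c /\ odd c /\ 0 < d /\ odd d) /\ a * b + c * d = 2 * m)
      (fun '(a, _, c, _) => chi a * chi c) = Dcount m.
Proof.
  intros hm om.
  pose (Q := fun '(a, b, c, d) => (0 < a /\ odd a /\ 0 < b /\ odd b) /\
                            (0 < c /\ odd c /\ 0 < d /\ odd d) /\ a * b + c * d = 2 * m).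
  assert (fQ : Fin Q).
  { apply (Fin_box4 (2 * m)). unfold Q; intros. nia. }
  fold Q.
  rewrite (Sum_disj (fun '(a, b, c, d) => Q (a, b, c, d) /\ a = c)
                    (fun '(a, b, c, d) => Q (a, b, c, d) /\ a <> c) Q); [|exact fQ| |].
  2:{ intros [[[a b] c] d]. tauto. }
  2:{ intros [[[a b] c] d]. tauto. }
  rewrite (Sum_disj (fun '(a, b, c, d) => Q (a, b, c, d) /\ c < a)
                    (fun '(a, b, c, d) => Q (a, b, c, d) /\ a < c)
                    (fun '(a, b, c, d) => Q (a, b, c, d) /\ a <> c)).
  2:{ apply (Fin_sub _ Q fQ). intros [[[a b] c] d]. tauto. }
  2:{ intros [[[a b] c] d]. assert (a <> c <-> c < a \/ a < c) by lia. tauto. }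
  2:{ intros [[[a b] c] d] [_ ?] [_ ?]. lia. }
  assert (gt : Sum (fun '(a, b, c, d) => Q (a, b, c, d) /\ c < a)
                   (fun '(a, _, c, _) => chi a * chi c) = 0).
  { rewrite <- (dirichlet_cancel m om).
    (* With [a = c + 2e] and [b + d = 2f] the equation becomes [eb + fc = m], and [chi a * chi c]
       becomes [eps e]. *)
    apply (Sum_bij (fun '(a, b, c, d) => ((a - c) / 2, (b + d) / 2, b, c))
                   (fun '(e, f, b, c) => (c + 2 * e, b, c, 2 * f - b))).
    - intros [[[a b] c] d] [((ha & oa & hb & ob) & (hc & oc & hd & od) & eq) lt].
      unfold odd in *.
      assert (exists e, a = c + 2 * e) as [e ->] by (exists ((a - c) / 2); lia).
      assert (exists f, d = 2 * f - b) as [f ->] by (exists ((b + d) / 2); lia).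
      replace ((c + 2 * e - c) / 2) with e by lia.
      replace ((b + (2 * f - b)) / 2) with f by lia.
      repeat split; try pair_lia.
      rewrite chi_shift, (Z.mul_comm (chi c)), <- Z.mul_assoc, chi_sqr; unfold odd; lia.
    - unfold Q, odd. intros [[[e f] b] c] (he & hf & hb & ob & hc & oc & eq).
      repeat split; pair_lia. }
  assert (lt : Sum (fun '(a, b, c, d) => Q (a, b, c, d) /\ a < c)
                   (fun '(a, _, c, _) => chi a * chi c) = 0).
  { rewrite <- gt.
    apply (Sum_bij (fun '(a, b, c, d) => (c, d, a, b)) (fun '(a, b, c, d) => (c, d, a, b)));
      unfold Q; intros [[[a b] c] d] [(h1 & h2 & eq) h]; repeat split; try tauto; lia. }
  rewrite gt, lt, Z.add_0_r. unfold Dcount.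
  (* For [a = c], put [s = (b + d) / 2]. Then [as = m], so [s] is odd, and [b = s + 2p],
     [d = s - 2p], [r = s - 2|p|]. *)
  apply (Sum_bij
    (fun '(a, b, c, d) => (a, (b + d) / 2 - 2 * Z.abs ((b - d) / 4), (b - d) / 4))
    (fun '(a, r, p) => (a, r + 2 * Z.abs p + 2 * p, a, r + 2 * Z.abs p - 2 * p))).
  - intros [[[a b] c] d] [((ha & oa & hb & ob) & (hc & oc & hd & od) & eq) <-].
    assert (exists s, d = 2 * s - b) as [s ->]
      by (exists ((b + d) / 2); unfold odd in *; lia).
    assert (e2 : a * s = m) by lia.
    assert (os : odd s) by (rewrite <- e2, odd_mul in om; tauto).
    unfold odd in *.
    assert (exists p, b = s + 2 * p) as [p ->] by (exists ((b - s) / 2); lia).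
    replace (2 * s - (s + 2 * p)) with (s - 2 * p) by lia.
    replace ((s + 2 * p + (s - 2 * p)) / 2) with s by lia.
    replace ((s + 2 * p - (s - 2 * p)) / 4) with p by lia.
    repeat split; try pair_lia. symmetry; now apply chi_sqr.
  - unfold Q, odd. intros [[a r] p] (ha & oa & hr & or & eq).
    repeat split; try pair_lia.
Qed.

Definition rep112 (m : Z) : Z :=
  Sum (fun '(x, u, y) => x * x + u * u + 2 * (y * y) = m) (fun _ => 1).

Lemma Fin_rep112 m : Fin (fun '(x, u, y) => x * x + u * u + 2 * (y * y) = m).
Proof. apply (Fin_box3 m). intros; nia. Qed.

Lemma Fin_twosq m : Fin (fun v => 2 * (v * v) <= m).
Proof. apply Fin_sub with (1 := Fin_interval m). intros; nia. Qed.

(** The left side counts solutions of [x^2 + u^2 + 2y^2 + 2v^2 = m]. Doubling gives [2m = i + j]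
    with [i = (x + u)^2 + (2y)^2] and [j = (x - u)^2 + (2v)^2], both odd because [x + u] is. By
    [odd_even_squares] each of [i], [j] contributes a factor [2 chi_div], and [dirichlet] evaluates
    the resulting sum. *)
Lemma rep1122 m : 0 < m -> odd m ->
  Sum (fun v => 2 * (v * v) <= m) (fun v => rep112 (m - 2 * (v * v))) = 4 * Dcount m.
Proof.
  intros hm om. rewrite <- dirichlet by assumption.
  pose (I := fun '(i, j) => 0 < i /\ 0 < j /\ odd i /\ odd j /\ i + j = 2 * m).
  assert (fI : Fin I) by (apply (Fin_box2 (2 * m)); unfold I; intros; lia).
  transitivity (Sum I (fun '(i, j) => (2 * chi_div i) * (2 * chi_div j))).
  - transitivity (Sum I (fun p =>
      Sum (fun '((x, y), (z, t)) => (odd x /\ x * x + y * y = fst p) /\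
                                    (odd z /\ z * z + t * t = snd p)) (fun _ => 1))).
    + unfold rep112.
      rewrite Sum_fibre; [|apply Fin_twosq|intros v _; apply Fin_rep112].
      rewrite Sum_fibre; [|exact fI|].
      2:{ intros [i j] _. apply Fin_sub with (1 := Fin_prod _ _ (Fin_rep2 i) (Fin_rep2 j)).
          intros [[x y] [z t]]; simpl; tauto. }
      apply (Sum_bij
        (fun '(v, (x, u, y)) =>
           (((x + u) * (x + u) + 2 * y * (2 * y), (x - u) * (x - u) + 2 * v * (2 * v)),
            ((x + u, 2 * y), (x - u, 2 * v))))
        (fun '((i, j), ((a, b), (c, d))) => (d / 2, ((a + c) / 2, (a - c) / 2, b / 2)))).
      * intros [v [[x u] y]] [hv e]. unfold I, fst, snd.
        assert (o1 : odd (x + u)).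
        { assert ((x + u) mod 2 = (x * x + u * u) mod 2).
          { rewrite Z.add_mod, (Z.add_mod (x * x)), (Z.mul_mod x), (Z.mul_mod u) by lia.
            assert (x mod 2 = 0 \/ x mod 2 = 1) as [->| ->] by lia;
            assert (u mod 2 = 0 \/ u mod 2 = 1) as [->| ->] by lia; reflexivity. }
          unfold odd in *; lia. }
        assert (o2 : odd (x - u)) by (unfold odd in *; lia).
        assert (o3 : odd ((x + u) * (x + u))) by (rewrite odd_mul; tauto).
        assert (o4 : odd ((x - u) * (x - u))) by (rewrite odd_mul; tauto).
        assert (x + u <> 0 /\ x - u <> 0) by (unfold odd in *; lia).
        repeat split; try pair_lia; try assumption; try nia; unfold odd in *; lia.
      * intros [[i j] [[a b] [c d]]]. unfold I, fst, snd.
        intros [(hi & hj & oi & oj & e) [[oa ea] [oc ec]]].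
        assert (hb : odd b -> False).
        { intros ob. rewrite <- ea in oi. pose proof (odd_mul a a).
          pose proof (odd_mul b b). unfold odd in *; lia. }
        assert (hd : odd d -> False).
        { intros od. rewrite <- ec in oj. pose proof (odd_mul c c).
          pose proof (odd_mul d d). unfold odd in *; lia. }
        unfold odd in *.
        assert (exists y, b = 2 * y) as [y ->] by (exists (b / 2); lia).
        assert (exists v, d = 2 * v) as [v ->] by (exists (d / 2); lia).
        assert (exists x u, a = x + u /\ c = x - u) as (x & u & -> & ->)
          by (exists ((a + c) / 2), ((a - c) / 2); lia).
        replace ((x + u + (x - u)) / 2) with x by lia.
        replace ((x + u - (x - u)) / 2) with u by lia.
        replace (2 * y / 2) with y by lia. replace (2 * v / 2) with v by lia.
        pose proof (Z.square_nonneg x). pose proof (Z.square_nonneg u).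
        pose proof (Z.square_nonneg y). pose proof (Z.square_nonneg v).
        repeat split; pair_lia.
    + apply Sum_ext; [tauto|]. intros [i j] (hi & hj & oi & oj & _).
      rewrite <- !odd_even_squares by assumption.
      rewrite Sum_prod.
      * apply Sum_ext; intros [[x y] [z t]]; simpl; tauto.
      * apply Fin_sub with (1 := Fin_rep2 i). intros [x y]; tauto.
      * apply Fin_sub with (1 := Fin_rep2 j). intros [x y]; tauto.
  - transitivity (4 * Sum I (fun p =>
      Sum (fun '((d, e), (d', e')) => (0 < d /\ 0 < e /\ odd e /\ d * e = fst p) /\
                                      (0 < d' /\ 0 < e' /\ odd e' /\ d' * e' = snd p))
          (fun '((_, e), (_, e')) => chi e * chi e'))).
    + rewrite Sum_scale. apply Sum_ext; [tauto|]. intros [i j] _.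
      transitivity (4 * (chi_div i * chi_div j)); [lia|]. f_equal.
      unfold chi_div. rewrite Sum_prod by apply Fin_divs.
      apply Sum_ext; intros [[x y] [z t]]; simpl; tauto.
    + f_equal. rewrite Sum_fibre; [|exact fI|].
      2:{ intros [i j] _. apply Fin_sub with (1 := Fin_prod _ _ (Fin_divs i) (Fin_divs j)).
          intros [[x y] [z t]]; simpl; tauto. }
      apply (Sum_bij (fun '(p, ((d, e), (d', e'))) => (e, d, e', d'))
                     (fun '(a, b, c, d) => ((a * b, c * d), ((b, a), (d, c))))).
      * intros [[i j] [[d e] [d' e']]]. unfold I, fst, snd.
        intros [(hi & hj & oi & oj & eq) [(hd & he & oe & e1) (hd' & he' & oe' & e2)]].
        rewrite <- e1, odd_mul in oi. rewrite <- e2, odd_mul in oj.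
        repeat split; try tauto; pair_lia.
      * intros [[[a b] c] d] ((ha & oa & hb & ob) & (hc & oc & hd & od) & eq).
        unfold I, fst, snd. rewrite !odd_mul.
        repeat split; try tauto; try (now apply Z.mul_pos_pos); lia.
Qed.

(** * The class number relation *)

(** A class number: [2k = a (a + 2r) - (a - 2p)^2], so this counts reduced binary
    forms with coefficients [a], [a - 2p], [a + 2r]. *)
Definition Gcount (k : Z) : Z :=
  Sum (fun '(a, p, r) => 0 < a /\ odd a /\ 0 < r /\ odd r /\ 0 <= p < a /\
                         2 * (p * (a - p)) + r * a = k)
      (fun _ => 1).

Lemma Fin_Gcount k :
  Fin (fun '(a, p, r) => 0 < a /\ odd a /\ 0 < r /\ odd r /\ 0 <= p < a /\
                         2 * (p * (a - p)) + r * a = k).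
Proof.
  apply (Fin_box3 k). intros a p r (ha & _ & hr & _ & hp & e).
  assert (0 <= p * (a - p)) by (apply Z.mul_nonneg_nonneg; lia). nia.
Qed.

(** The equation [2v^2 + 2p(a - p) + ra = m] after [v = p + k], with the upper bound on [p] dropped.
    The reflection [(v, p) -> (-v, a - p)] negates [a + 2k], which may therefore be taken positive;
    a negative [p] records that the reflection was applied. *)
Definition V1 (m : Z) : Z * Z * Z * Z -> Prop := fun '(a, k, p, r) =>
  0 < a /\ odd a /\ 0 < r /\ odd r /\ 0 < a + 2 * k /\
  2 * (k * k) + 2 * (Z.abs p * (a + 2 * k)) + r * a = m.

(** The excess of [V1] outside [-a <= p < a], after [j = k + a] and lowering [|p|] by [a]. *)
Definition V2 (m : Z) : Z * Z * Z * Z -> Prop := fun '(a, j, p, r) =>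
  0 < a /\ odd a /\ 0 < r /\ odd r /\ a < 2 * j /\
  2 * (j * j) + 2 * (Z.abs p * (2 * j - a)) + r * a = m.

Lemma Fin_V1 m : Fin (V1 m).
Proof.
  apply (Fin_box4 m). unfold V1. intros a k p r (ha & _ & hr & _ & hA & e).
  assert (0 <= Z.abs p * (a + 2 * k)) by (apply Z.mul_nonneg_nonneg; lia).
  assert (Z.abs p <= Z.abs p * (a + 2 * k)) by nia.
  assert (0 < r * a) by (apply Z.mul_pos_pos; lia).
  assert (a <= r * a) by nia. assert (r <= r * a) by nia.
  assert (Z.abs k <= k * k) by nia.
  lia.
Qed.

Lemma Fin_V2 m : Fin (V2 m).
Proof.
  apply (Fin_box4 m). unfold V2. intros a k p r (ha & _ & hr & _ & hA & e).
  assert (0 <= Z.abs p * (2 * k - a)) by (apply Z.mul_nonneg_nonneg; lia).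
  assert (Z.abs p <= Z.abs p * (2 * k - a)) by nia.
  assert (0 < r * a) by (apply Z.mul_pos_pos; lia).
  assert (a <= r * a) by nia. assert (r <= r * a) by nia.
  assert (Z.abs k <= k * k) by nia.
  lia.
Qed.

(** Tuples of [V1] with [-a <= p < a] are those counted by the convolution: [0 <= p] when
    [a + 2(v - p) > 0], and [p < 0] after reflection otherwise. Shifting [p] towards 0 by [a]
    carries the others to [V2]; the half-open range ensures that [p = 0] in [V2] is reached from
    [p = a] only. *)
Lemma Gcount_convolution m :
  Sum (fun v => 2 * (v * v) <= m) (fun v => Gcount (m - 2 * (v * v))) + Sum (V2 m) (fun _ => 1) =
  Sum (V1 m) (fun _ => 1).
Proof.
  unfold Gcount. rewrite Sum_fibre; [|apply Fin_twosq|intros v _; apply Fin_Gcount].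
  rewrite (Sum_disj (fun '(a, k, p, r) => V1 m (a, k, p, r) /\ - a <= p < a)
                    (fun '(a, k, p, r) => V1 m (a, k, p, r) /\ ~ (- a <= p < a)) (V1 m)).
  2:{ apply Fin_V1. }
  2:{ intros [[[a k] p] r]; tauto. }
  2:{ intros [[[a k] p] r]; tauto. }
  f_equal.
  - apply (Sum_bij
      (fun '(v, (a, p, r)) => if Z_lt_dec 0 (a + 2 * (v - p))
                              then (a, v - p, p, r) else (a, p - v - a, p - a, r))
      (fun '(a, k, p, r) => if Z_lt_dec p 0
                            then (p - k, (a, a + p, r)) else (p + k, (a, p, r)))).
    + intros [v [[a p] r]] [hv (ha & oa & hr & or & hp & e)]. unfold V1, odd in *.
      destruct (Z_lt_dec 0 (a + 2 * (v - p))).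
      * destruct (Z_lt_dec p 0); [lia|]. rewrite Z.abs_eq by lia.
        repeat split; pair_lia.
      * destruct (Z_lt_dec (p - a) 0); [|lia]. rewrite Z.abs_neq by lia.
        repeat split; pair_lia.
    + intros [[[a k] p] r] [(ha & oa & hr & or & hA & e) hp]. unfold odd in *.
      pose proof (Z.mul_pos_pos r a hr ha).
      pose proof (Z.mul_nonneg_nonneg (Z.abs p) (a + 2 * k) ltac:(lia) ltac:(lia)).
      destruct (Z_lt_dec p 0).
      * rewrite Z.abs_neq in * by lia.
        pose proof (Z.mul_nonneg_nonneg (a + p) (- p) ltac:(lia) ltac:(lia)).
        destruct (Z_lt_dec 0 (a + 2 * (p - k - (a + p)))); [lia|].
        repeat split; pair_lia.
      * rewrite Z.abs_eq in * by lia.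
        pose proof (Z.mul_nonneg_nonneg p (a - p) ltac:(lia) ltac:(lia)).
        destruct (Z_lt_dec 0 (a + 2 * (p + k - p))); [|lia].
        repeat split; pair_lia.
  - symmetry. apply (Sum_bij
      (fun '(a, k, p, r) => if Z_lt_dec p 0 then (a, a + k, p + a, r) else (a, a + k, p - a, r))
      (fun '(a, j, p, r) => if Z_lt_dec p 0 then (a, j - a, p - a, r) else (a, j - a, p + a, r))).
    + intros [[[a k] p] r] [(ha & oa & hr & or & hA & e) hp]. unfold V2, odd in *.
      destruct (Z_lt_dec p 0).
      * destruct (Z_lt_dec (p + a) 0); [|lia]. rewrite Z.abs_neq in * by lia.
        repeat split; pair_lia.
      * destruct (Z_lt_dec (p - a) 0); [lia|]. rewrite Z.abs_eq in * by lia.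
        repeat split; pair_lia.
    + intros [[[a j] p] r] (ha & oa & hr & or & hA & e). unfold V1, odd in *.
      destruct (Z_lt_dec p 0).
      * destruct (Z_lt_dec (p - a) 0); [|lia]. rewrite Z.abs_neq in * by lia.
        repeat split; pair_lia.
      * destruct (Z_lt_dec (p + a) 0); [lia|]. rewrite Z.abs_eq in * by lia.
        repeat split; pair_lia.
Qed.

Lemma Sum_abs (P : Z * Z * Z * Z -> Prop) :
  Fin P -> (forall a k p r, P (a, k, p, r) -> P (a, k, - p, r)) ->
  Sum P (fun _ => 1) =
  Sum (fun '(a, k, p, r) => P (a, k, p, r) /\ p = 0) (fun _ => 1) +
  2 * Sum (fun '(a, k, p, r) => P (a, k, p, r) /\ 0 < p) (fun _ => 1).
Proof.
  intros fP hP.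
  rewrite (Sum_disj (fun '(a, k, p, r) => P (a, k, p, r) /\ p = 0)
                    (fun '(a, k, p, r) => P (a, k, p, r) /\ p <> 0) P).
  2:{ exact fP. }
  2:{ intros [[[a k] p] r]; tauto. }
  2:{ intros [[[a k] p] r]; tauto. }
  rewrite (Sum_disj (fun '(a, k, p, r) => P (a, k, p, r) /\ 0 < p)
                    (fun '(a, k, p, r) => P (a, k, p, r) /\ p < 0)
                    (fun '(a, k, p, r) => P (a, k, p, r) /\ p <> 0)).
  2:{ apply (Fin_sub _ P fP). intros [[[a k] p] r]; tauto. }
  2:{ intros [[[a k] p] r]. assert (p <> 0 <-> 0 < p \/ p < 0) by lia. tauto. }
  2:{ intros [[[a k] p] r] [_ ?] [_ ?]; lia. }
  rewrite (Sum_bij (fun '(a, k, p, r) => (a, k, - p, r)) (fun '(a, k, p, r) => (a, k, - p, r))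
             (fun '(a, k, p, r) => P (a, k, p, r) /\ p < 0)
             (fun '(a, k, p, r) => P (a, k, p, r) /\ 0 < p) _ (fun _ => 1)); [lia| |];
  intros [[[a k] p] r] [? ?]; repeat split; auto; pair_lia.
Qed.

(** Common coordinates for the tuples with [p > 0] of [V1] (where [k <> 0]) and of [V2]. For fixed
    [j] and [R] the equation is linear in [a] and [q]. *)
Definition ladder (m : Z) : Z * Z * Z * Z -> Prop := fun '(j, a, R, q) =>
  0 < j /\ 0 < a /\ odd a /\ 0 < R /\ odd R /\ 2 * (j * j) + R * a + 2 * (j * q) = m.

(** Along the line [R a + 2 j q = const] the representative with [0 < a < 2j]
    is exchanged for the one with [0 <= q < R]. *)
Lemma ladder_reduce m :
  Sum (fun '(j, a, R, q) => ladder m (j, a, R, q) /\ a < 2 * j /\ 0 < q) (fun _ => 1) =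
  Sum (fun '(j, a, R, q) => ladder m (j, a, R, q) /\ 0 <= q < R /\ (q = 0 -> 2 * j < a))
      (fun _ => 1).
Proof.
  apply (Sum_bij (fun '(j, a, R, q) => (j, a + 2 * j * (q / R), R, q mod R))
                 (fun '(j, a, R, q) => (j, a mod (2 * j), R, q + R * (a / (2 * j))))).
  - intros [[[j a] R] q] [(hj & ha & oa & hR & oR & e) [haj hq]].
    pose proof (Z.div_mod q R ltac:(lia)) as dm.
    pose proof (Z.mod_pos_bound q R ltac:(lia)) as mb.
    pose proof (Z.div_pos q R ltac:(lia) ltac:(lia)) as kp.
    revert dm mb kp. generalize (q / R) (q mod R). intros t q' -> mb kp.
    destruct (divmod_unique (a + 2 * j * t) (2 * j) t a ltac:(lia) ltac:(lia)) as [-> ->].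
    pose proof (Z.mul_nonneg_nonneg j t ltac:(lia) kp).
    unfold ladder, odd in *. repeat split; try pair_lia.
    (* A positive [q] with remainder 0 has quotient at least 1, so the new [a] exceeds [2j]. *)
    intros ->. assert (t <> 0) by (intros ->; lia). nia.
  - intros [[[j a] R] q] [(hj & ha & oa & hR & oR & e) [hq hq0]].
    pose proof (Z.div_mod a (2 * j) ltac:(lia)) as dm.
    pose proof (Z.mod_pos_bound a (2 * j) ltac:(lia)) as mb.
    pose proof (Z.div_pos a (2 * j) ltac:(lia) ltac:(lia)) as kp.
    revert dm mb kp. generalize (a / (2 * j)) (a mod (2 * j)). intros t a' -> mb kp.
    destruct (divmod_unique (q + R * t) R t q ltac:(lia) ltac:(lia)) as [-> ->].
    unfold ladder, odd in *.
    assert (oa' : a' mod 2 = 1) by lia.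
    repeat split; try pair_lia.
    destruct (Z.eq_dec q 0) as [->|]; [|nia].
    assert (t <> 0) by (intros ->; lia). nia.
Qed.

(** The tuples with [k = 0] are those of [Dcount]. For the rest, [p] is paired with [-p], both sides
    are moved to the ladder, and [ladder_reduce] matches them up to boundary tuples, which
    cancel. *)
Lemma V1_V2 m : odd m ->
  Sum (V1 m) (fun _ => 1) = Dcount m + Sum (V2 m) (fun _ => 1).
Proof.
  intros om.
  rewrite (Sum_disj (fun '(a, k, p, r) => V1 m (a, k, p, r) /\ k = 0)
                    (fun '(a, k, p, r) => V1 m (a, k, p, r) /\ k <> 0) (V1 m)).
  2:{ apply Fin_V1. }
  2:{ intros [[[a k] p] r]; tauto. }
  2:{ intros [[[a k] p] r]; tauto. }
  f_equal.
  { apply (Sum_bij (fun '(a, k, p, r) => (a, r, p)) (fun '(a, r, p) => (a, 0, p, r))).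
    - intros [[[a k] p] r] [(ha & oa & hr & or & hA & e) ->].
      repeat split; auto; lia.
    - intros [[a r] p] (ha & oa & hr & or & e). unfold V1. repeat split; auto; lia. }
  rewrite (Sum_abs (fun '(a, k, p, r) => V1 m (a, k, p, r) /\ k <> 0)).
  2:{ apply Fin_sub with (1 := Fin_V1 m). intros [[[a k] p] r]; tauto. }
  2:{ intros a k p r. unfold V1. now rewrite Z.abs_opp. }
  rewrite (Sum_abs (V2 m)).
  2:{ apply Fin_V2. }
  2:{ intros a k p r. unfold V2. now rewrite Z.abs_opp. }
  (* For [k > 0], [ra + 2p(a + 2k)] regroups as [(r + 2p)a + 2k(2p)]; for [k = -j < 0], as
     [(r + 2p)(a - 2j) + 2jr]. The parity of [q], which is [2p] or [r], tells the cases apart. *)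
  assert (e1 : Sum (fun '(a, k, p, r) => (V1 m (a, k, p, r) /\ k <> 0) /\ 0 < p) (fun _ => 1) =
    Sum (fun '(j, a, R, q) => ladder m (j, a, R, q) /\ 0 < q < R) (fun _ => 1)).
  { apply (Sum_bij
      (fun '(a, k, p, r) => if Z_lt_dec 0 k then (k, a, r + 2 * p, 2 * p)
                            else (- k, a + 2 * k, r + 2 * p, r))
      (fun '(j, a, R, q) => if Z.eq_dec (q mod 2) 0 then (a, j, q / 2, R - q)
                            else (a + 2 * j, - j, (R - q) / 2, q))).
    - intros [[[a k] p] r] [[(ha & oa & hr & or & hA & e) hk] hp].
      rewrite Z.abs_eq in e by lia. unfold ladder, odd in *.
      destruct (Z_lt_dec 0 k).
      + destruct (Z.eq_dec ((2 * p) mod 2) 0); [|lia]. repeat split; pair_lia.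
      + destruct (Z.eq_dec (r mod 2) 0); [lia|]. repeat split; pair_lia.
    - intros [[[j a] R] q] [(hj & ha & oa & hR & oR & e) hq]. unfold V1, odd in *.
      destruct (Z.eq_dec (q mod 2) 0) as [ev|od].
      + destruct (Z_lt_dec 0 j); [|lia]. rewrite Z.abs_eq by lia.
        assert (exists p, q = 2 * p) as [p ->] by (exists (q / 2); lia).
        replace (2 * p / 2) with p by lia. repeat split; pair_lia.
      + destruct (Z_lt_dec 0 (- j)); [lia|]. rewrite Z.abs_eq by lia.
        assert (exists p, R = q + 2 * p) as [p ->] by (exists ((R - q) / 2); lia).
        replace ((q + 2 * p - q) / 2) with p by lia. repeat split; pair_lia. }
  (* Likewise [ra + 2p(2j - a)] equals both [(r - 2p)a + 2j(2p)] and [(2p - r)(2j - a) + 2jr]; the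
     form with [R > 0] is taken, and [R] is nonzero because [r] is odd. *)
  assert (e2 : Sum (fun '(a, j, p, r) => V2 m (a, j, p, r) /\ 0 < p) (fun _ => 1) =
    Sum (fun '(j, a, R, q) => ladder m (j, a, R, q) /\ a < 2 * j /\ 0 < q) (fun _ => 1)).
  { apply (Sum_bij
      (fun '(a, j, p, r) => if Z_lt_dec (2 * p) r then (j, a, r - 2 * p, 2 * p)
                            else (j, 2 * j - a, 2 * p - r, r))
      (fun '(j, a, R, q) => if Z.eq_dec (q mod 2) 0 then (a, j, q / 2, R + q)
                            else (2 * j - a, j, (R + q) / 2, q))).
    - intros [[[a j] p] r] [(ha & oa & hr & or & hA & e) hp].
      rewrite Z.abs_eq in e by lia. unfold ladder, odd in *.
      destruct (Z_lt_dec (2 * p) r).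
      + destruct (Z.eq_dec ((2 * p) mod 2) 0); [|lia]. repeat split; pair_lia.
      + destruct (Z.eq_dec (r mod 2) 0); [lia|]. repeat split; pair_lia.
    - intros [[[j a] R] q] [(hj & ha & oa & hR & oR & e) hq]. unfold V2, odd in *.
      destruct (Z.eq_dec (q mod 2) 0) as [ev|od].
      + assert (exists p, q = 2 * p) as [p ->] by (exists (q / 2); lia).
        replace (2 * p / 2) with p by lia. rewrite Z.abs_eq by lia.
        destruct (Z_lt_dec (2 * p) (R + 2 * p)); [|lia]. repeat split; pair_lia.
      + assert (exists p, R = 2 * p - q) as [p ->] by (exists ((R + q) / 2); lia).
        replace ((2 * p - q + q) / 2) with p by lia. rewrite Z.abs_eq by lia.
        destruct (Z_lt_dec (2 * p) q); [lia|]. repeat split; pair_lia. }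
  (* The boundary tuples. In [V1] they occur twice, for [k = j] and [k = -j]; on the side of [V2]
     they occur once, at [q = 0], in a ladder sum that carries the factor 2. *)
  pose (ZZ := fun '(a, j, p, r) => V1 m (a, j, p, r) /\ p = 0 /\ 0 < j /\ 2 * j < a).
  assert (e3 : Sum (fun '(a, k, p, r) => (V1 m (a, k, p, r) /\ k <> 0) /\ p = 0) (fun _ => 1) =
    Sum (fun '(a, j, p, r) => V2 m (a, j, p, r) /\ p = 0) (fun _ => 1) +
    2 * Sum ZZ (fun _ => 1)).
  { rewrite (Sum_disj (fun '(a, k, p, r) => (V1 m (a, k, p, r) /\ k < 0) /\ p = 0)
                      (fun '(a, k, p, r) => (V1 m (a, k, p, r) /\ 0 < k) /\ p = 0)).
    2:{ apply Fin_sub with (1 := Fin_V1 m). intros [[[a k] p] r]; tauto. }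
    2:{ intros [[[a k] p] r]. assert (k <> 0 <-> k < 0 \/ 0 < k) by lia. tauto. }
    2:{ intros [[[a k] p] r] [[_ ?] _] [[_ ?] _]; lia. }
    rewrite (Sum_disj (fun '(a, j, p, r) => V2 m (a, j, p, r) /\ p = 0) ZZ
               (fun '(a, k, p, r) => (V1 m (a, k, p, r) /\ 0 < k) /\ p = 0)).
    2:{ apply Fin_sub with (1 := Fin_V1 m). intros [[[a k] p] r]; tauto. }
    2:{ intros [[[a k] p] r]. unfold ZZ, V1, V2, odd.
        split.
        - intros [[(ha & oa & hr & or & hA & e) hk] ->]. change (Z.abs 0) with 0 in *.
          destruct (Z_lt_dec a (2 * k)); [left|right]; repeat split; lia.
        - intros [[(ha & oa & hr & or & hA & e) ->]|[(ha & oa & hr & or & hA & e) (-> & hj & hlt)]];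
            change (Z.abs 0) with 0 in *; repeat split; lia. }
    2:{ intros [[[a k] p] r]. unfold ZZ, V2. lia. }
    rewrite (Sum_bij (fun '(a, k, p, r) => (a, - k, p, r)) (fun '(a, k, p, r) => (a, - k, p, r))
               (fun '(a, k, p, r) => (V1 m (a, k, p, r) /\ k < 0) /\ p = 0)
               ZZ _ (fun _ => 1)).
    - lia.
    - intros [[[a k] p] r] [[(ha & oa & hr & or & hA & e) hk] ->]. unfold ZZ, V1, odd in *.
      change (Z.abs 0) with 0 in *. repeat split; pair_lia.
    - intros [[[a k] p] r] [(ha & oa & hr & or & hA & e) (-> & hj & hlt)]. unfold V1, odd in *.
      change (Z.abs 0) with 0 in *. repeat split; pair_lia. }
  assert (fl : Fin (fun '(j, a, R, q) => ladder m (j, a, R, q) /\ 0 <= q < R /\ (q = 0 -> 2 * j < a))).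
  { apply (Fin_box4 m). intros j a R q [(hj & ha & oa & hR & oR & e) [hq _]].
    pose proof (Z.mul_nonneg_nonneg j q ltac:(lia) ltac:(lia)).
    assert (a <= R * a) by nia. assert (R <= R * a) by nia. assert (j <= j * j) by nia. lia. }
  assert (e4 : Sum (fun '(j, a, R, q) => ladder m (j, a, R, q) /\ 0 <= q < R /\ (q = 0 -> 2 * j < a))
      (fun _ => 1) =
    Sum (fun '(j, a, R, q) => ladder m (j, a, R, q) /\ 0 < q < R) (fun _ => 1) +
    Sum ZZ (fun _ => 1)).
  { rewrite (Sum_disj (fun '(j, a, R, q) => ladder m (j, a, R, q) /\ 0 < q < R)
                      (fun '(j, a, R, q) => ladder m (j, a, R, q) /\ q = 0 /\ 2 * j < a)).
    2:{ exact fl. }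
    2:{ intros [[[j a] R] q]. split.
        - intros [h [? ?]]. destruct (Z.eq_dec q 0); [right|left]; (split; [exact h|lia]).
        - intros [[h ?]|[h [? ?]]]; (split; [exact h|]); unfold ladder in h; lia. }
    2:{ intros [[[j a] R] q]. lia. }
    f_equal.
    apply (Sum_bij (fun '(j, a, R, q) => (a, j, q, R)) (fun '(a, j, q, R) => (j, a, R, q))).
    - intros [[[j a] R] q] [(hj & ha & oa & hR & oR & e) [-> hq]]. unfold ZZ, V1, odd in *.
      change (Z.abs 0) with 0 in *. repeat split; pair_lia.
    - intros [[[a j] q] R] [(ha & oa & hr & or & hA & e) (-> & hj & hlt)].
      unfold ladder, odd in *.
      change (Z.abs 0) with 0 in *. repeat split; pair_lia. }
  rewrite e1, e2, e3, ladder_reduce, e4. lia.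
Qed.

Lemma Gcount_sum m : odd m ->
  Sum (fun v => 2 * (v * v) <= m) (fun v => Gcount (m - 2 * (v * v))) = Dcount m.
Proof.
  intros om. pose proof (Gcount_convolution m). rewrite V1_V2 in H by assumption. lia.
Qed.

(** * Ternary forms and the theorem *)

(** By [rep1122] and [Gcount_sum], [rep112] and [4 Gcount] have the same sum over [v]. The term
    [v = 0] is the value at [m]; the others have arguments [m - 2v^2] that are smaller, odd and
    hence positive. *)
Lemma rep112_Gcount m : 0 < m -> odd m -> rep112 m = 4 * Gcount m.
Proof.
  intros hm. assert (h0 : 0 <= m) by lia. revert m h0 hm.
  apply (Z_lt_induction (fun m => 0 < m -> odd m -> rep112 m = 4 * Gcount m)).
  intros m IH hm om.
  assert (step : forall F,
    Sum (fun v => 2 * (v * v) <= m) (fun v => F (m - 2 * (v * v))) =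
    F m + Sum (fun v => 2 * (v * v) <= m /\ v <> 0) (fun v => F (m - 2 * (v * v)))).
  { intros F.
    rewrite (Sum_disj (fun v => v = 0) (fun v => 2 * (v * v) <= m /\ v <> 0)).
    - rewrite (Sum_single 0) by tauto. do 2 f_equal. lia.
    - apply Fin_twosq.
    - intros v. destruct (Z.eq_dec v 0) as [->|]; lia.
    - lia. }
  pose proof (rep1122 m hm om) as r. pose proof (Gcount_sum m om) as g.
  rewrite step in r, g.
  assert (e : Sum (fun v => 2 * (v * v) <= m /\ v <> 0) (fun v => rep112 (m - 2 * (v * v))) =
    4 * Sum (fun v => 2 * (v * v) <= m /\ v <> 0) (fun v => Gcount (m - 2 * (v * v)))).
  { rewrite Sum_scale. apply Sum_ext; [tauto|]. intros v [hv v0].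
    assert (0 < v * v) by nia.
    apply IH; unfold odd in *; lia. }
  lia.
Qed.

Lemma Gcount_pos m : 0 < m -> odd m -> 0 < Gcount m.
Proof.
  intros hm om. unfold Gcount.
  destruct (Fin_Gcount m) as [l hl]. rewrite (Sum_enum _ _ l hl).
  destruct hl as [_ el].
  assert (i : In (1, 0, m) l) by (apply el; repeat split; auto; lia).
  clear el. assert (nonneg : forall l' : list (Z * Z * Z), 0 <= lsum (fun _ => 1) l')
    by (induction l'; simpl; lia).
  destruct l as [|x l]; [destruct i|]. simpl. specialize (nonneg l). lia.
Qed.

Lemma odd_repr m : 0 < m -> odd m -> exists x u y, x * x + u * u + 2 * (y * y) = m.
Proof.
  intros hm om. apply NNPP; intros h.
  assert (z : rep112 m = 0).
  { apply Sum_empty. intros [[x u] y] e. apply h; eauto. }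
  pose proof (rep112_Gcount m hm om). pose proof (Gcount_pos m hm om). lia.
Qed.

Lemma odd_repr_parity m : 0 < m -> odd m ->
  exists x z y, x * x + (2 * z) * (2 * z) + 2 * (y * y) = m.
Proof.
  intros hm om. destruct (odd_repr m hm om) as (x & u & y & e).
  pose proof (odd_mul x x). pose proof (odd_mul u u). unfold odd in *.
  assert (u mod 2 = 0 \/ x mod 2 = 0) as [h|h] by lia.
  - exists x, (u / 2), y. replace (2 * (u / 2)) with u by lia. lia.
  - exists u, (x / 2), y. replace (2 * (x / 2)) with x by lia. lia.
Qed.

Lemma universal_1_2 : universal 1 2.
Proof.
  intros n hn. unfold form.
  (* Odd [n] is handled with [w = 0], even [n >= 4] with [w = 1], which leaves the odd number
     [n - 3]; 0 and 2 are too small for this. *)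
  assert (n = 0 \/ n = 2 \/ odd n \/ (0 < n - 3 /\ odd (n - 3))) as [->|[->|[h|[hp h]]]]
    by (unfold odd; lia).
  - exists 0, 0, 0, 0; reflexivity.
  - exists 0, 1, 0, 0; reflexivity.
  - destruct (odd_repr_parity n) as (x & z & y & e); [unfold odd in h; lia|assumption|].
    exists x, y, z, 0. lia.
  - destruct (odd_repr_parity (n - 3)) as (x & z & y & e); [assumption|assumption|].
    assert (odd x).
    { pose proof (odd_mul x x). unfold odd in *.
      assert (x mod 2 = 1 \/ x mod 2 = 0) as [|h0] by lia; lia. }
    assert (exists t, x = 2 * t + 1) as [t ->] by (exists (x / 2); unfold odd in *; lia).
    (* Since [4 (t^2 + t + 1) = (2t + 1)^2 + 3], the odd square goes into the binary form and the
       even square becomes the [x] term. *)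
    exists (2 * z), y, t, 1. lia.
Qed.

Theorem theorem6p3 (a b : Z) (ha : 0 < a) (hb : 0 < b) (hab : a <= b) :
  universal a b <-> (a = 1 /\ b = 2).
Proof.
  split; [|intros [-> ->]; exact universal_1_2].
  intros U.
  assert (N : forall z w, 0 <= z ^ 2 + z * w + w ^ 2) by (intros; nia).
  assert (S : forall t, t = 0 \/ 1 <= t ^ 2) by (intros; nia).
  (* If [x = y = 0] the value is a multiple of 4, otherwise it is at least [a]; representing 1
     forces [a = 1]. *)
  assert (a1 : a = 1).
  { destruct (U 1 ltac:(lia)) as (x & y & z & w & e). unfold form in e.
    specialize (N z w).
    destruct (S x) as [->|]; [|nia].
    destruct (S y) as [->|]; [lia|nia]. }
  subst a. split; [reflexivity|].
  (* If [b >= 3], representing 2 would require [y = 0], a vanishing binary form and [x^2 = 2]. *)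
  assert (b <= 2).
  { destruct (U 2 ltac:(lia)) as (x & y & z & w & e). unfold form in e.
    specialize (N z w).
    destruct (S y) as [->|]; [|nia].
    assert (z ^ 2 + z * w + w ^ 2 = 0) by nia.
    assert (-1 <= x <= 1) by nia. assert (x = -1 \/ x = 0 \/ x = 1) as [->|[->| ->]] by lia; lia. }
  (* For [b = 1] the value is congruent to [x^2 + y^2] modulo 4, which is never 3. *)
  enough (b <> 1) by lia. intros ->.
  destruct (U 3 ltac:(lia)) as (x & y & z & w & e). unfold form in e.
  assert (sq : forall t, t ^ 2 mod 4 = 0 \/ t ^ 2 mod 4 = 1).
  { intros t. rewrite Z.pow_2_r, Z.mul_mod by lia.
    assert (t mod 4 = 0 \/ t mod 4 = 1 \/ t mod 4 = 2 \/ t mod 4 = 3) as [->|[->|[->| ->]]]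
      by lia; cbv; lia. }
  pose proof (sq x). pose proof (sq y). lia.
Qed.
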